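(* Let $\beta,E\in\mathbb{R}$ and $\rho\in[0,1]$, and consider the speed changed ASEP with jump rates $$\alpha_2=1,\quad \alpha_3=\tfrac12(1+e^{-\beta}),\quad \alpha_4=e^{-\beta},\qquad \gamma_2=e^{-\beta}e^{-E},\quad \gamma_3=\tfrac12(1+e^{-\beta})e^{-E},\quad \gamma_4=e^{-E}.$$ Then its stationary current satisfies $$J(\rho,\beta,E)=J_+(\rho,\beta)(1-e^{-E}),$$ where the positive current $J_+$ is given by $$J_+(\rho,\beta)=\frac{2\rho(1-\rho)\left[e^{\beta}+\sqrt{(1-2\rho)^2+4\rho(1-\rho)e^{\beta}}\right]}{e^{\beta}\left[1+\sqrt{(1-2\rho)^2+4\rho(1-\rho)e^{\beta}}\right]^2},$$ and its integrated covariance is given by $$A(\rho,\beta,E)=\rho(1-\rho)\sqrt{(1-2\rho)^2+4\rho(1-\rho)e^{\beta}}.$$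
   Context: Configurations are $\eta\in\{0,1\}^{\mathbb{Z}}$ ($\eta(x)=1$ means a particle at $x$). The speed changed ASEP is the exclusion process in which a particle at $x$ jumps to an empty nearest-neighbour site $y$ at rate $c_\eta(x,y)$. Right jumps from $j$ to $j+1$ (when $\eta(j)=1,\eta(j+1)=0$) have rate $c_\eta(j,j+1)=\alpha_2$ if $(\eta(j-1),\eta(j+2))=(0,1)$; $=\alpha_3$ if $(\eta(j-1),\eta(j+2))\in\{(0,0),(1,1)\}$; $=\alpha_4$ if $(\eta(j-1),\eta(j+2))=(1,0)$. Left jumps from $j+1$ to $j$ (when $\eta(j)=0,\eta(j+1)=1$) have rate $c_\eta(j+1,j)=\gamma_2$ if $(\eta(j-1),\eta(j+2))=(0,1)$; $=\gamma_3$ if $(\eta(j-1),\eta(j+2))\in\{(0,0),(1,1)\}$; $=\gamma_4$ if $(\eta(j-1),\eta(j+2))=(1,0)$. The stationary measure $\mu_\rho$ of density $\rho$ is the translation-invariant (infinite-volume, one-dimensional nearest-neighbour Gibbs) probability measure on $\{0,1\}^{\mathbb{Z}}$ formally given by $$\mu_\rho(\eta)=\frac1Z\exp\Big(\beta\sum_i\eta(i)\eta(i+1)+h\sum_i\eta(i)\Big),$$ where $Z$ is the normalization and $h=h(\rho,\beta)$ is chosen so that $\mu_\rho(\eta(0)=1)=\rho$ (for $\rho=0$ or $\rho=1$, $\mu_\rho$ is the point mass on the empty, respectively full, configuration). Writing $\mu_\rho(f)$ for the expectation of $f$, the positive current is $J_+(\rho,\beta)=\mu_\rho\big(c_\eta(0,1)\eta(0)(1-\eta(1))\big)$,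 the stationary current is $$J(\rho,\beta,E)=\mu_\rho\big(c_\eta(0,1)\eta(0)(1-\eta(1))\big)-\mu_\rho\big(c_\eta(1,0)\eta(1)(1-\eta(0))\big),$$ and the integrated covariance is $$A(\rho,\beta,E)=\sum_{j\in\mathbb{Z}}\big(\mu_\rho(\eta(0)\eta(j))-\rho^2\big).$$ *)

(* Defs.v *)
From mathcomp Require Import all_boot all_order all_algebra finmap.
From mathcomp Require Import all_classical all_reals all_analysis.

Set Implicit Arguments.
Unset Strict Implicit.
Unset Printing Implicit Defensive.

Import Order.TTheory GRing.Theory Num.Theory.
Local Open Scope classical_set_scope.
Local Open Scope ring_scope.

(* The occupation variable [eta x] is a boolean; as a real number it is
   [(eta x)%:R], through the coercion from [bool] to [nat]. *)
Definition config : Type := int -> bool.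

Definition coordinate_sets (S : set int) : set (set config) :=
  [set C : set config | exists2 x, S x & C = [set eta : config | eta x]].

(* {0,1}^Z with its product sigma-algebra. *)
Definition configs : Type := g_sigma_algebraType (coordinate_sets setT).

(* Sub-sigma-algebra generated by the occupation variables at the sites of S. *)
Definition sigma_sites (S : set int) : set (set configs) :=
  <<s coordinate_sets S >>.

Definition shift_config (k : int) (eta : config) : config := fun x => eta (x + k).

Definition translation_invariant {R : realType} (mu : probability configs R) :=
  forall (k : int) (C : set configs), measurable C ->
    mu (shift_config k @^-1` C) = mu C.

(* The configuration equal to s on L and to w off L. *)
Definition glue (L : {fset int}) (s : {ffun L -> bool}) (w : config) : config :=
  fun i => if insub i is Some k then s k else w i.

(* Exponent of the Gibbs weight in the finite volume L: all the bonds
   {i, i + 1} that meet L, boundary bonds included, and the sites of L. *)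
Definition gibbs_exponent {R : realType} (beta h : R) (L : {fset int})
    (eta : config) : R :=
  beta * (\sum_(i <- (L `|` [fset i - 1 | i in L])%fset)
            (eta i)%:R * (eta (i + 1))%:R)
  + h * (\sum_(i <- L) (eta i)%:R).

Definition partition_function {R : realType} (beta h : R) (L : {fset int})
    (w : config) : R :=
  \sum_(s : {ffun L -> bool}) expR (gibbs_exponent beta h L (glue s w)).

(* Probability of s in the volume L under the boundary condition w. *)
Definition gibbs_kernel {R : realType} (beta h : R) (L : {fset int})
    (s : {ffun L -> bool}) (w : config) : R :=
  expR (gibbs_exponent beta h L (glue s w)) / partition_function beta h L w.

(* DLR equations: given the configuration off L, the conditional law on L is
   the finite-volume Gibbs law, for every finite volume L. *)
Definition gibbs_measure {R : realType} (beta h : R)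
    (mu : probability configs R) : Prop :=
  forall (L : {fset int}) (s : {ffun L -> bool}) (F : set configs),
    sigma_sites (~` [set` L]) F ->
    mu ([set eta : configs | forall k : L, eta (val k) = s k] `&` F) =
    (\int[mu]_(w in F) (gibbs_kernel beta h s w)%:E)%E.

(* mu is the law mu_rho; the third clause determines h from rho and beta. *)
Definition stationary_measure {R : realType} (beta rho : R)
    (mu : probability configs R) : Prop :=
  [/\ rho = 0 -> forall C : set configs, measurable C ->
        mu C = dirac ((fun=> false) : configs) C,
      rho = 1 -> forall C : set configs, measurable C ->
        mu C = dirac ((fun=> true) : configs) C
    & 0 < rho < 1 ->
        exists h : R, [/\ gibbs_measure beta h mu,
          translation_invariant mu
        & mu [set eta : configs | eta 0] = rho%:E] ].

Record rates (R : Type) := Rates {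
  alpha2 : R; alpha3 : R; alpha4 : R;
  gamma2 : R; gamma3 : R; gamma4 : R }.

Definition by_outer_sites {R : Type} (r2 r3 r4 : R) (l r : bool) : R :=
  match l, r with
  | false, true => r2
  | false, false | true, true => r3
  | true, false => r4
  end.

(* The rate c_eta(x, y) of a jump from x to y. Only its values at an occupied
   x and an empty nearest neighbour y matter. For a left jump, from j + 1 to
   j, we have y = j, so that the outer sites j - 1, j + 2 are y - 1, x + 1. *)
Definition jump_rate {R : realType} (c : rates R) (eta : config) (x y : int)
    : R :=
  if y == x + 1 then
    by_outer_sites (alpha2 c) (alpha3 c) (alpha4 c) (eta (x - 1)) (eta (y + 1))
  else if x == y + 1 then
    by_outer_sites (gamma2 c) (gamma3 c) (gamma4 c) (eta (y - 1)) (eta (x + 1))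
  else 0.

(* Expectations are taken in \bar R; those of the bounded cylinder functions
   below are finite. *)
Definition positive_current {R : realType} (c : rates R)
    (mu : probability configs R) : \bar R :=
  ('E_mu[fun eta : configs =>
     (jump_rate c eta 0 1 * (eta 0)%:R * (1 - (eta 1)%:R))%R])%E.

Definition negative_current {R : realType} (c : rates R)
    (mu : probability configs R) : \bar R :=
  ('E_mu[fun eta : configs =>
     (jump_rate c eta 1 0 * (eta 1)%:R * (1 - (eta 0)%:R))%R])%E.

Definition stationary_current {R : realType} (c : rates R)
    (mu : probability configs R) : \bar R :=
  (positive_current c mu - negative_current c mu)%E.

Definition covariance_term {R : realType} (rho : R) (mu : probability configs R)
    (j : int) : \bar R :=
  ('E_mu[fun eta : configs => ((eta 0)%:R * (eta j)%:R)%R] - (rho ^+ 2)%:E)%E.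

(* Unordered sum over Z. Each of the two sums is in [0, +oo], and
   +oo - +oo = -oo in \bar R, so this is a real number exactly when the family
   is absolutely summable. *)
Definition integrated_covariance {R : realType} (rho : R)
    (mu : probability configs R) : \bar R :=
  (\esum_(j in [set: int]) (covariance_term rho mu)^\+ j
   - \esum_(j in [set: int]) (covariance_term rho mu)^\- j)%E.

Definition speed_changed_rates {R : realType} (beta E : R) : rates R :=
  {| alpha2 := 1;
     alpha3 := 2^-1 * (1 + expR (- beta));
     alpha4 := expR (- beta);
     gamma2 := expR (- beta) * expR (- E);
     gamma3 := 2^-1 * (1 + expR (- beta)) * expR (- E);
     gamma4 := expR (- E) |}.

(* Main.v *)
(**
  For a nearest-neighbour Gibbs measure, the single-site DLR equation relates
  the law of a pair (n, n + 1) to that of the next pair (n + 1, n + 2), jointly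
  with any event G to the left of n. With a hole at n, the deviations of the
  odds of finding a particle at n + 1 from the two fixed points theta > 0 and
  - tau < 0 of this relation are multiplied by 1 - tau and 1 + theta. As
  |1 - tau| < 1 + theta and the first deviation is dominated by the second,
  the first one vanishes: the measure is a Markov chain, with odds theta of a
  particle after a hole and e^beta theta after a particle. Stationarity of the
  chain gives rho = theta (1 + e^beta theta) / N with
  N = 1 + 2 theta + e^beta theta^2, whence the square root in the statement is
  (1 + 2 e^beta theta + e^beta theta^2) / N. The currents are sums over blocks
  of four sites, and the covariances are geometric in the distance.
*)

Require Import Defs.
From mathcomp Require Import all_boot all_order all_algebra finmap.
From mathcomp Require Import all_classical all_reals all_analysis.
From mathcomp Require Import measurable_realfun ring lra zify.

Import Order.TTheory GRing.Theory Num.Theory.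
Import numFieldNormedType.Exports.
Local Open Scope classical_set_scope.
Local Open Scope ring_scope.

(** * Unordered sums of geometric families over the integers *)

Lemma esum_int {R : realType} (a : int -> \bar R) : (forall j, 0 <= a j)%E ->
  \esum_(j in [set: int]) a j =
  (\esum_(n in [set: nat]) a (Posz n) + \esum_(n in [set: nat]) a (Negz n))%E.
Proof.
move=> a0; rewrite (esumID (range Posz))// !setTI.
have -> : ~` range Posz = range Negz.
  apply/seteqP; split=> [[n|n] /= np|_ [n _ <-] [m _]] //.
    by case: np; exists n.
  by exists n.
by rewrite !esum_image// => m n _ _ [].
Qed.

Lemma esum_nat_EFin {R : realType} (g : nat -> R) (s : R) :
  (forall n, 0 <= g n) -> series g n @[n --> \oo] --> s ->
  \esum_(n in [set: nat]) (g n)%:E = s%:E.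
Proof.
move=> g0 gs; rewrite -nneseries_esumT; last by move=> n; rewrite lee_fin.
apply/cvg_lim => //.
under eq_fun do rewrite sumEFin.
by apply: cvg_EFin => //; exact: nearW.
Qed.

(** The family is the difference of the nonnegative summable families [c * |x|^n] and
    [c * |x|^n - c * x^n], so [esumB] reduces the claim to ordinary geometric series. The two
    half-lines contribute [c / (1 - x)] and [c x / (1 - x)]. *)
Lemma esum_int_geometric {R : realType} (c x : R) : 0 <= c -> `|x| < 1 ->
  (\esum_(j in [set: int]) (fun j : int => (c * x ^+ `|j|)%:E)^\+ j
   - \esum_(j in [set: int]) (fun j : int => (c * x ^+ `|j|)%:E)^\- j)%E
  = (c * (1 + x) / (1 - x))%:E.
Proof.
move=> c0 x1.
have nx1 : `| `|x| | < 1 by rewrite normr_id.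
have x_lt1 : x < 1 by move: x1; rewrite ltr_norml => /andP[].
pose y : R := `|x|; pose f (n : nat) : R := c * y ^+ n; pose g n := f n - c * x ^+ n.
have f0 n : 0 <= f n by rewrite mulr_ge0// exprn_ge0// normr_ge0.
have g0 n : 0 <= g n by rewrite /g /f subr_ge0 ler_wpM2l// /y -normrX ler_norm.
have fs d : series (fun n => d * y ^+ n) n @[n --> \oo] --> d / (1 - y).
  exact: (@cvg_geometric_series R d y nx1).
have gs d e : series (fun n => d * y ^+ n - e * x ^+ n) n @[n --> \oo]
    --> d / (1 - y) - e / (1 - x).
  rewrite [X in X n @[n --> _] --> _](_ : _ =
    series (fun n => d * y ^+ n) - series (fun n => e * x ^+ n)).
    by apply: cvgB; [exact: fs|exact: (@cvg_geometric_series R e x x1)].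
  by apply/funext => n; rewrite /series /= sumrB.
have fS : \esum_(j in [set: int]) (f `|j|%N)%:E = (c / (1 - y) + (c * y) / (1 - y))%:E.
  rewrite esum_int; last by move=> j; rewrite lee_fin.
  rewrite EFinD; congr (_ + _)%E; apply: esum_nat_EFin => //; first exact: fs.
  (* [Negz n] is [-(n + 1)], whence the extra factor [y] on the negative half-line. *)
  have -> : (fun n : nat => f `|Negz n|%N) = (fun n => c * y * y ^+ n).
    by apply/funext => n; rewrite /f exprS mulrA.
  exact: fs.
have gS : \esum_(j in [set: int]) (g `|j|%N)%:E =
    (c / (1 - y) - c / (1 - x) + (c * y / (1 - y) - c * x / (1 - x)))%:E.
  rewrite esum_int; last by move=> j; rewrite lee_fin.
  rewrite EFinD; congr (_ + _)%E; apply: esum_nat_EFin => //; first exact: gs.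
  have -> : (fun n : nat => g `|Negz n|%N) =
      (fun n => c * y * y ^+ n - c * x * x ^+ n).
    by apply/funext => n; rewrite /g /f !exprS !mulrA.
  exact: gs.
have := @esumB R int setT (fun j => (f `|j|%N)%:E) (fun j => (g `|j|%N)%:E).
rewrite fS gS /summable.
have -> : (fun j : int => (f `|j|%N)%:E - (g `|j|%N)%:E)%E =
    fun j : int => (c * x ^+ `|j|)%:E.
  by apply/funext => j; rewrite -EFinB /g opprB addrC subrK.
have abs_fin (u : nat -> R) (v : R) : 
    (forall n, 0 <= u n) -> \esum_(j in [set: int]) (u `|j|%N)%:E = v%:E ->
    (\esum_(j in [set: int]) `|(u `|j|%N)%:E| < +oo)%E.
  move=> u0 uv.
  rewrite (eq_esum (b := fun j : int => (u `|j|%N)%:E)) ?uv ?ltry// => j _.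
  by rewrite gee0_abs// lee_fin.
move=> -> //; [|exact: abs_fin fS|exact: abs_fin gS| |];
  try by move=> j _; rewrite lee_fin.
by rewrite -EFinB; congr _%:E; field; rewrite !gt_eqF// subr_gt0.
Qed.

(** * Cylinder events and their probabilities *)

Definition site (x : int) (a : bool) : set configs := [set eta | eta x = a].

Lemma sigma_sites_site (S : set int) x a : S x -> sigma_sites S (site x a).
Proof.
move=> Sx; have S1 : sigma_sites S (site x true).
  by apply: sub_sigma_algebra; exists x.
case: a => //; have -> : site x false = setT `\` site x true.
  by apply/seteqP; split=> eta; rewrite /site /=; case: (eta x) => //= -[].
by apply: sigma_algebraCD.
Qed.

Lemma sigma_sitesI (S : set int) A B :
  sigma_sites S A -> sigma_sites S B -> sigma_sites S (A `&` B).
Proof. exact: (@measurableI _ (g_sigma_algebraType (coordinate_sets S))). Qed.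

Lemma sub_sigma_sites (S T : set int) A :
  S `<=` T -> sigma_sites S A -> sigma_sites T A.
Proof.
move=> ST sA.
have ST' : coordinate_sets S `<=` coordinate_sets T.
  by move=> _ [x Sx ->]; exists x => //; exact: ST.
exact: (sub_sigma_algebra2 ST' sA).
Qed.

Lemma sigma_sites_measurable (S : set int) A :
  sigma_sites S A -> measurable (A : set configs).
Proof. exact: (@sub_sigma_sites _ setT). Qed.

Lemma measurable_site x a : measurable (site x a).
Proof. exact: (@sigma_sites_measurable setT _ (sigma_sites_site _ _ _ I)). Qed.

Definition prob {R : realType} (mu : probability configs R) (A : set configs) : R :=
  fine (mu A).

Section probability.
Context {R : realType} (mu : probability configs R).

Lemma probE A : measurable A -> mu A = (prob mu A)%:E.
Proof. by move=> mA; rewrite fineK// fin_num_measure. Qed.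

Lemma prob_ge0 A : 0 <= prob mu A.
Proof. exact: fine_ge0. Qed.

Lemma prob_split x A : measurable A ->
  prob mu A = prob mu (A `&` site x false) + prob mu (A `&` site x true).
Proof.
move=> mA; have mI a : measurable (A `&` site x a).
  by apply: measurableI => //; exact: measurable_site.
apply: EFin_inj; rewrite EFinD -!probE// -measureU//.
- congr (mu _); apply/seteqP; split=> eta; rewrite /site /=; last by case=> -[].
  by case: (eta x); [right|left].
- by apply/seteqP; split=> eta //=; rewrite /site /= => -[[_ ->] [_]].
Qed.

Lemma expectation_sum_indic (I : finType) (a : I -> R) (A : I -> set configs) :
  (forall i, 0 <= a i) -> (forall i, measurable (A i)) ->
  ('E_mu[fun eta => (\sum_i a i * \1_(A i) eta)%R])%E =
  (\sum_i a i * prob mu (A i))%:E.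
Proof.
move=> a0 mA; rewrite unlock.
under eq_integral do rewrite -sumEFin.
rewrite ge0_integral_sum//=; last 2 first.
- move=> i; apply/measurable_EFinP; exact: measurable_funM.
- by move=> i eta _; rewrite lee_fin mulr_ge0.
rewrite -sumEFin; apply: eq_bigr => i _.
under eq_integral do rewrite EFinM.
rewrite ge0_integralZl_EFin//=; last first.
  by apply/measurable_EFinP; exact: measurable_indic.
by rewrite integral_indic// setIT EFinM -probE.
Qed.
End probability.

(** * The single-site DLR equation and the recursion on neighbouring pairs *)

Section gibbs.
Context {R : realType} (beta h : R) (mu : probability configs R).
Hypothesis hmu : gibbs_measure beta h mu.

(** Only the bonds starting at [x - 1] and at [x] meet the volume, and both products vanish when [x]
    is empty. *)
Lemma gibbs_exponent1 (x : int) (s : {ffun [fset x]%fset -> bool}) (w : config) :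
  gibbs_exponent beta h [fset x]%fset (Defs.glue s w) =
  ((s (FSetSub (fset11 x)))%:R * (beta * ((w (x - 1))%:R + (w (x + 1))%:R) + h)).
Proof.
rewrite /gibbs_exponent.
have -> : [fset i - 1 | i in [fset x]]%fset = [fset x - 1]%fset.
  by apply/fsetP => y; rewrite imfset_fset1.
rewrite big_fsetU1/=; last by rewrite inE eq_sym -subr_eq0; lia.
rewrite !big_seq_fset1 subrK.
have gx : Defs.glue s w x = s (FSetSub (fset11 x)).
  rewrite /Defs.glue; case: insubP => [u _ ux|]; last by rewrite fset11.
  by congr (s _); apply: val_inj.
have gy y : y != x -> Defs.glue s w y = w y.
  by move=> yx; rewrite /Defs.glue insubF// inE (negbTE yx).
rewrite gx !gy; [ring|lia|lia].
Qed.

(** Fixing both neighbours of [x] makes the one-site kernel constant. In the ratio of a particle to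
    a hole at [x] the partition function cancels, and the hole has weight 1. *)
Lemma single_site_dlr x l r G : sigma_sites [set y | y != x] G ->
  prob mu (G `&` site (x - 1) l `&` site (x + 1) r `&` site x true) =
  expR (beta * (l%:R + r%:R) + h) *
  prob mu (G `&` site (x - 1) l `&` site (x + 1) r `&` site x false).
Proof.
move=> sG.
set F := G `&` _ `&` _.
have sF : sigma_sites (~` [set` [fset x]%fset]) F.
  apply: sigma_sitesI; [apply: sigma_sitesI|].
  - by apply: sub_sigma_sites sG => y /=; rewrite inE => /negP.
  - by apply: sigma_sites_site => /=; rewrite inE; lia.
  - by apply: sigma_sites_site => /=; rewrite inE; lia.
have mF := @sigma_sites_measurable _ _ sF.
have [F0|/set0P[w0 Fw0]] := eqVneq F set0.
  by rewrite F0 !set0I /prob measure0 mulr0.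
(* Any [w0] in [F] represents the boundary condition, so the DLR integral over [F] is the kernel at
   [w0] times [mu F]. *)
have muF a : mu (F `&` site x a) =
    ((@gibbs_kernel R beta h [fset x]%fset [ffun=> a] w0)%:E * mu F)%E.
  have -> : F `&` site x a =
      [set eta : configs |
        forall k : [fset x]%fset, eta (val k) = [ffun=> a] k] `&` F.
    apply/seteqP; split=> eta; rewrite /site /= => -[].
      move=> Feta <-; split=> // k; rewrite ffunE.
      by move: (valP k); rewrite inE => /eqP ->.
    by move=> /(_ (FSetSub (fset11 x))); rewrite ffunE /= => ->.
  rewrite (hmu _ _ _ sF) -(@integral_cst _ _ _ mu F mF).
  apply: eq_integral => w; rewrite inE => Fw.
  congr (_%:E); rewrite /gibbs_kernel /partition_function.
  case: Fw (Fw0) => -[_ wl] wr [[_ w0l] w0r].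
  have ew (s : {ffun [fset x]%fset -> bool}) :
      gibbs_exponent beta h [fset x]%fset (Defs.glue s w) =
      gibbs_exponent beta h [fset x]%fset (Defs.glue s w0).
    by rewrite !gibbs_exponent1 wl wr w0l w0r.
  by rewrite ew; congr (_ / _); apply: eq_bigr => s _; rewrite ew.
rewrite /prob !muF !fineM ?fin_num_measure//= mulrA.
congr (_ * _); rewrite /gibbs_kernel mulrA; congr (_ / _).
case: Fw0 => -[_ w0l] w0r.
by rewrite -expRD !gibbs_exponent1 !ffunE w0l w0r mul1r mul0r addr0.
Qed.

Local Notation z := (expR h).
Local Notation b := (expR beta).
Local Notation below n := (sigma_sites [set y | y < n]).
Local Notation pair_prob G n l r :=
  (prob mu (G `&` site n l `&` site (n + 1) r)).

Lemma below_site G (n : int) a : below n G -> below (n + 1) (G `&` site n a).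
Proof.
move=> sG; apply: sigma_sitesI; last by apply: sigma_sites_site => /=; lia.
by apply: sub_sigma_sites sG => y /=; lia.
Qed.

Lemma measurable_pair G (n : int) l r :
  measurable G -> measurable (G `&` site n l `&` site (n + 1) r).
Proof.
move=> mG; apply: measurableI (measurable_site _ _).
exact: measurableI (measurable_site _ _).
Qed.

Lemma pair_probF G (n : int) l : measurable G ->
  pair_prob G n l false = pair_prob (G `&` site n l) (n + 1) false false
                        + pair_prob (G `&` site n l) (n + 1) false true.
Proof. by move=> mG; apply: prob_split; exact: measurable_pair. Qed.

Lemma triple_probT G (n : int) l r : below n G ->
  pair_prob (G `&` site n l) (n + 1) true r =
  z * b ^+ l * b ^+ r * pair_prob (G `&` site n l) (n + 1) false r.
Proof.
move=> sG.
have dlr := @single_site_dlr (n + 1) l r G.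
rewrite addrK in dlr.
rewrite ![_ `&` site (n + 1) _ `&` _]setIAC dlr; last first.
  by apply: sub_sigma_sites sG => y /=; lia.
have bE (a : bool) : expR (beta * a%:R) = b ^+ a.
  by case: a; rewrite ?mulr1 ?mulr0 ?expR0.
by congr (_ * _); rewrite expRD mulrDr expRD !bE mulrC mulrA.
Qed.

(** Splitting on the site [n + 2] and trading the particle at [n + 1] for a hole leaves only pairs
    that start with a hole. For [l = false] this closes the recursion on the odds. *)
Lemma pair_probT G (n : int) l : below n G ->
  pair_prob G n l true =
    z * b ^+ l * (pair_prob (G `&` site n l) (n + 1) false false
                + b * pair_prob (G `&` site n l) (n + 1) false true).
Proof.
move=> sG; have mG := @sigma_sites_measurable _ _ sG.
rewrite (@prob_split _ _ (n + 1 + 1)); last exact: measurable_pair.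
by rewrite !triple_probT//= expr0 expr1; ring.
Qed.

(* The odds of a particle to the right of a hole obey [r = z (1 + b r') / (1 + r')],
   where [r'] are the odds one site further; [theta] is the positive fixed
   point of this Moebius map and [- tau] the negative one. *)
Lemma fixed_points_exist : {tt : R * R |
  [/\ 0 < tt.1, 0 < tt.2, tt.1 - tt.2 = z * b - 1 & tt.1 * tt.2 = z]}.
Proof.
have z0 := expR_gt0 h.
(* The fixed points are the roots of [t^2 - p t - z], with discriminant [d^2]; as [z > 0], they have
   opposite signs. *)
set p := z * b - 1; set d := Num.sqrt (p ^+ 2 + 4 * z).
have d2 : d ^+ 2 = p ^+ 2 + 4 * z by rewrite sqr_sqrtr//; nra.
have d0 : 0 <= d by exact: sqrtr_ge0.
exists ((d + p) / 2, (d - p) / 2) => /=; split; [nra|nra|by field|].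
by transitivity ((d ^+ 2 - p ^+ 2) / 4); [by field|by rewrite d2; field].
Qed.

(** * Contraction to the positive fixed point and the Markov property *)

Section fixed_points.
Variables theta tau : R.
Hypotheses (theta0 : 0 < theta) (tau0 : 0 < tau).
Hypotheses (theta_sub_tau : theta - tau = z * b - 1) (theta_tau : theta * tau = z).

(** The lower bound amounts to [tau - theta = 1 - z b < 2]. *)
Lemma contraction_ratio : `|1 - tau| < 1 + theta.
Proof.
have zb0 : 0 < z * b by rewrite mulr_gt0 ?expR_gt0.
rewrite ltr_norml.
by apply/andP; split; move: theta0 tau0 theta_sub_tau zb0; set zb := (z * b); lra.
Qed.

(** The deviation of the odds from [t], multiplied by the probability of two holes: it is linear in
    the probabilities and needs no division by one that may vanish. *)
Definition defect t G (n : int) :=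
  pair_prob G n false true - t * pair_prob G n false false.

(** After expansion over the next pair, the coefficients are [z b - theta = 1 - tau] and
    [z - theta = - theta (1 - tau)]. The same computation with [- tau] in place of [theta] gives the
    factor [1 + theta]. *)
Lemma defect_theta G (n : int) : below n G ->
  defect theta G n = (1 - tau) * defect theta (G `&` site n false) (n + 1).
Proof.
move=> sG; have mG := @sigma_sites_measurable _ _ sG.
rewrite /defect pair_probT// (@pair_probF G n false mG)/= expr0 mulr1 mulrDr mulrA.
have -> : z * b = 1 + theta - tau by move: theta_sub_tau; lra.
by rewrite -theta_tau; ring.
Qed.

Lemma defect_tau G (n : int) : below n G ->
  defect (- tau) G n = (1 + theta) * defect (- tau) (G `&` site n false) (n + 1).
Proof.
move=> sG; have mG := @sigma_sites_measurable _ _ sG.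
rewrite /defect pair_probT// (@pair_probF G n false mG)/= expr0 mulr1 mulrDr mulrA.
have -> : z * b = 1 + theta - tau by move: theta_sub_tau; lra.
by rewrite -theta_tau; ring.
Qed.

Lemma defect_tau_ge0 G (n : int) : 0 <= defect (- tau) G n.
Proof. by rewrite /defect mulNr opprK addr_ge0 ?mulr_ge0 ?prob_ge0// ltW. Qed.

(** The constant makes both coefficients on the right, [1 + theta / tau] and [tau + theta], dominate
    [1] and [theta]. *)
Lemma defect_le G (n : int) :
  `|defect theta G n| <= (1 + theta / tau) * defect (- tau) G n.
Proof.
have := prob_ge0 mu (G `&` site n false `&` site (n + 1) false).
have := prob_ge0 mu (G `&` site n false `&` site (n + 1) true).
rewrite /defect mulNr opprK; set x := prob _ _; set y := prob _ _ => x0 y0.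
have t0 : 0 <= theta / tau by rewrite divr_ge0// ltW.
have -> : (1 + theta / tau) * (x + tau * y) =
   x + tau * y + theta / tau * x + theta * y by field; rewrite gt_eqF.
have : 0 <= theta / tau * x by exact: mulr_ge0.
have : 0 <= tau * y by rewrite mulr_ge0// ltW.
have : 0 <= theta * y by rewrite mulr_ge0// ltW.
by rewrite ler_norml => ? ? ?; apply/andP; split; lra.
Qed.

(** Both defects are pushed through [k] further holes, compared there by [defect_le], and the
    [- tau] defect is pulled back to [n], which divides by [(1 + theta)^k]. *)
Lemma defect_geometric k G (n : int) : below n G ->
  `|defect theta G n| <=
  (`|1 - tau| / (1 + theta)) ^+ k * ((1 + theta / tau) * defect (- tau) G n).
Proof.
elim: k G n => [|k IH] G n sG; first by rewrite expr0 mul1r defect_le.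
rewrite defect_theta// normrM.
have := IH _ _ (@below_site G n false sG); move/(ler_wpM2l (normr_ge0 (1 - tau))).
move=> /le_trans; apply; rewrite (@defect_tau G n sG) exprS le_eqVlt; apply/orP; left.
by apply/eqP; field; rewrite !gt_eqF// addr_gt0.
Qed.

Lemma defect_eq0 G (n : int) : below n G -> defect theta G n = 0.
Proof.
move=> sG; apply/eqP; rewrite -normr_le0.
have t1 : 0 < 1 + theta by rewrite addr_gt0.
have q1 : `| `|1 - tau| / (1 + theta) | < 1.
  by rewrite normrM normr_id normfV (gtr0_norm t1) ltr_pdivrMr// mul1r
    contraction_ratio.
(* The left side does not depend on [k], while the bound tends to 0. *)
apply: (cvgr_to_ge (cvg_geometric ((1 + theta / tau) * defect (- tau) G n) q1)).
by apply: nearW => k; rewrite /geometric /= mulrC defect_geometric.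
Qed.

Lemma markov_hole G (n : int) : below n G ->
  pair_prob G n false true = theta * pair_prob G n false false.
Proof. by move/defect_eq0/eqP; rewrite subr_eq0 => /eqP. Qed.

(** The fixed-point equation of [theta], cleared of its denominator. *)
Lemma activity_eq : z * (1 + b * theta) = theta * (1 + theta).
Proof.
rewrite mulrDr mulr1 mulrA.
have -> : z * b = 1 + theta - tau by move: theta_sub_tau; lra.
by rewrite -theta_tau; ring.
Qed.

(** The recursion expresses both sides by pairs with a hole at [n + 1], whose odds are already known
    to be [theta], the particle at [n] being absorbed into the past event. *)
Lemma markov_particle G (n : int) : below n G ->
  pair_prob G n true true = b * theta * pair_prob G n true false.
Proof.
move=> sG; have mG := @sigma_sites_measurable _ _ sG.
rewrite pair_probT// (@pair_probF G n true mG)/= expr1.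
rewrite markov_hole; last exact: below_site.
set p := pair_prob _ _ _ _.
transitivity (b * (z * (1 + b * theta)) * p); first by ring.
by rewrite activity_eq; ring.
Qed.

End fixed_points.
Lemma gibbs_markov : {theta : R | 0 < theta &
  forall (G : set configs) (n : int), below n G ->
    pair_prob G n false true = theta * pair_prob G n false false /\
    pair_prob G n true true = b * theta * pair_prob G n true false}.
Proof.
have [[theta tau] /= [theta0 tau0 e1 e2]] := fixed_points_exist.
exists theta => // G n sG.
by split; [exact: (markov_hole theta tau)|exact: (markov_particle theta tau)].
Qed.

End gibbs.

(** * Currents and covariances as probabilities of cylinder events *)

(** The outer sites are written [0 - 1] and [1 + 1] to match the unfolding of [jump_rate] on the
    bond between 0 and 1. *)
Definition block (l a b r : bool) : set configs :=
  site (0 - 1) l `&` site 0 a `&` site 1 b `&` site (1 + 1) r.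

Lemma measurable_block l a b r : measurable (block l a b r).
Proof. rewrite /block; do 3 apply: measurableI (measurable_site _ _).
exact: measurable_site. Qed.

Lemma indic_block {R : realType} l a b r (eta : configs) :
  \1_(block l a b r) eta = ((eta (0 - 1) == l) && (eta 0%R == a) &&
    (eta 1%R == b) && (eta (1 + 1) == r))%:R :> R.
Proof.
rewrite indicE; congr (nat_of_bool _)%:R; apply/idP/idP; rewrite inE.
  by move=> [[[-> ->] ->] ->]; rewrite !eqxx.
by move=> /andP[/andP[/andP[/eqP ? /eqP ?] /eqP ?] /eqP ?].
Qed.

Section currents.
Context {R : realType} (mu : probability configs R) (c : rates R).

Lemma positive_currentE : 0 <= alpha2 c -> 0 <= alpha3 c -> 0 <= alpha4 c ->
  positive_current c mu =
  (\sum_(lr : bool * bool) by_outer_sites (alpha2 c) (alpha3 c) (alpha4 c) lr.1 lr.2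
     * prob mu (block lr.1 true false lr.2))%:E.
Proof.
move=> a2 a3 a4; rewrite -expectation_sum_indic; last 2 first.
- by case=> -[] [].
- by move=> lr; exact: measurable_block.
congr ('E_mu[_])%E; apply/funext => eta.
rewrite /jump_rate /= -(pair_bigA _ (fun l r => by_outer_sites _ _ _ l r *
  \1_(block l true false r) eta))/= !big_bool/= !indic_block.
by case: (eta _) (eta 0) (eta 1) (eta _) => -[] [] []/=;
  rewrite ?(mulr0, mulr1, addr0, add0r, subrr, subr0).
Qed.

Lemma negative_currentE : 0 <= gamma2 c -> 0 <= gamma3 c -> 0 <= gamma4 c ->
  negative_current c mu =
  (\sum_(lr : bool * bool) by_outer_sites (gamma2 c) (gamma3 c) (gamma4 c) lr.1 lr.2
     * prob mu (block lr.1 false true lr.2))%:E.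
Proof.
move=> a2 a3 a4; rewrite -expectation_sum_indic; last 2 first.
- by case=> -[] [].
- by move=> lr; exact: measurable_block.
congr ('E_mu[_])%E; apply/funext => eta.
rewrite /jump_rate /= -(pair_bigA _ (fun l r => by_outer_sites _ _ _ l r *
  \1_(block l false true r) eta))/= !big_bool/= !indic_block.
by case: (eta _) (eta 0) (eta 1) (eta _) => -[] [] []/=;
  rewrite ?(mulr0, mulr1, addr0, add0r, subrr, subr0).
Qed.

Lemma covariance_termE (rho : R) (j : int) : covariance_term rho mu j =
  (prob mu (site 0 true `&` site j true) - rho ^+ 2)%:E.
Proof.
have mA : measurable (site 0 true `&` site j true).
  by apply: measurableI; exact: measurable_site.
rewrite /covariance_term EFinB -probE// -expectation_indic//.
congr ('E_mu[_] - _)%E; apply/funext => eta.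
rewrite indicE -natrM mulnb; congr (nat_of_bool _)%:R.
by apply/idP/idP; rewrite inE /site /=; [move/andP|case=> -> ->].
Qed.

End currents.

(** * The stationary two-state Markov chain *)

Section stationary.
Context {R : realType} (b theta rho : R) (mu : probability configs R).
Hypotheses (b0 : 0 < b) (theta0 : 0 < theta).
Hypothesis inv_mu : translation_invariant mu.
Hypothesis rhoE : prob mu (site 0 true) = rho.
Hypothesis markov : forall (G : set configs) (n : int),
  sigma_sites [set y | y < n] G ->
  prob mu (G `&` site n false `&` site (n + 1) true) =
    theta * prob mu (G `&` site n false `&` site (n + 1) false) /\
  prob mu (G `&` site n true `&` site (n + 1) true) =
    b * theta * prob mu (G `&` site n true `&` site (n + 1) false).

(** The transition matrix of the chain: odds [t] of a particle become the probabilities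
    [t / (1 + t)] and [1 / (1 + t)]. *)
Definition transition (l r : bool) : R :=
  let t := if l then b * theta else theta in (if r then t else 1) / (1 + t).

Lemma markov_transition G (n : int) l r : sigma_sites [set y | y < n] G ->
  prob mu (G `&` site n l `&` site (n + 1) r) =
  transition l r * prob mu (G `&` site n l).
Proof.
move=> sG; have [h0 h1] := markov G n sG.
have mG : measurable (G `&` site n l).
  apply: measurableI (measurable_site _ _).
  exact: sigma_sites_measurable sG.
have bt0 : 0 < b * theta by exact: mulr_gt0.
rewrite [in RHS](@prob_split _ _ (n + 1))// /transition.
by case: l r mG => -[] mG; rewrite ?h0 ?h1; field; rewrite gt_eqF// addr_gt0.
Qed.

Lemma prob_shift (k x y : int) a a' :
  prob mu (site (x + k) a `&` site (y + k) a') = prob mu (site x a `&` site y a').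
Proof.
rewrite /prob -(inv_mu k (site x a `&` site y a'))//.
by apply: measurableI; exact: measurable_site.
Qed.

Lemma prob_site (n : int) : prob mu (site n true) = rho.
Proof. by have := prob_shift n 0 0 true true; rewrite add0r !setIid rhoE. Qed.

Lemma prob_site_false (n : int) : prob mu (site n false) = 1 - rho.
Proof.
have := @prob_split _ mu n setT measurableT; rewrite !setTI prob_site.
by rewrite /prob probability_setT /= => ->; rewrite addrK.
Qed.

Lemma sigma_sitesT (S : set int) : sigma_sites S setT.
Proof. exact: (@measurableT _ (g_sigma_algebraType (coordinate_sets S))). Qed.

Lemma prob_pair (n : int) l r : prob mu (site n l `&` site (n + 1) r) =
  transition l r * prob mu (site n l).
Proof. by have := @markov_transition setT n l r (sigma_sitesT _); rewrite setTI. Qed.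

Lemma balance : rho = transition false true * (1 - rho) + transition true true * rho.
Proof.
rewrite -{1}(prob_site (0 + 1)) (@prob_split _ _ 0); last exact: measurable_site.
by rewrite ![site (0 + 1) _ `&` _]setIC !prob_pair prob_site prob_site_false.
Qed.

Lemma prob_block l a a' r : prob mu (block l a a' r) =
  (if l then rho else 1 - rho) * transition l a * transition a a' * transition a' r.
Proof.
have -> : (if l then rho else 1 - rho) = prob mu (site (0 - 1) l).
  by case: l; rewrite ?prob_site ?prob_site_false.
have s1 : sigma_sites [set y | y < 0] (site (0 - 1) l) by exact: sigma_sites_site.
have s2 : sigma_sites [set y | y < 1] (site (0 - 1) l `&` site 0 a).
  by apply: sigma_sitesI; exact: sigma_sites_site.
rewrite /block (markov_transition _ 1)// (markov_transition _ 0)//.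
by rewrite (prob_pair (0 - 1)); ring.
Qed.

(** The base [lam] is the second eigenvalue of the transition matrix. By stationarity its entries
    are affine in [lam], so the correlations satisfy [u (n + 1) = lam * u n + (1 - lam) * rho^2]. *)
Lemma correlation (n : nat) :
  prob mu (site 0 true `&` site n%:Z true) =
  rho ^+ 2 + rho * (1 - rho) * (transition true true - transition false true) ^+ n.
Proof.
have bal := balance; set lam := transition true true - _.
have q01 : transition false true = rho * (1 - lam).
  transitivity (rho - transition true true * rho + transition false true * rho).
    by rewrite {1}bal; ring.
  by rewrite /lam; ring.
have q11 : transition true true = lam + rho * (1 - lam).
  by rewrite -q01 /lam; ring.
elim: n => [|n IH]; first by rewrite setIid prob_site; ring.
(* Distance 1 is separate: the Markov property at site [n] needs the event at site 0 to lie strictly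
   to its left. *)
case: n IH => [|n] IH.
  by rewrite (prob_pair 0) prob_site q11; ring.
have -> : n.+2%:Z = n.+1%:Z + 1 by lia.
rewrite (@prob_split _ _ n.+1%:Z); last by apply: measurableI; exact: measurable_site.
have s0 : sigma_sites [set y | y < n.+1%:Z] (site 0 true) by exact: sigma_sites_site.
rewrite ![_ `&` site (_ + 1) _ `&` _]setIAC !markov_transition// IH.
have := @prob_split _ mu n.+1%:Z _ (measurable_site 0 true).
rewrite prob_site IH => /(canLR (addrK _)) <-.
by rewrite q01 q11 (exprS lam n.+1); ring.
Qed.

Lemma correlation_int (j : int) :
  prob mu (site 0 true `&` site j true) - rho ^+ 2 =
  rho * (1 - rho) * (transition true true - transition false true) ^+ `|j|.
Proof.
case: j => n; first by rewrite correlation; ring.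
have := prob_shift n.+1%:Z 0 (Negz n) true true.
rewrite NegzE addNr add0r setIC => <-.
by rewrite correlation abszN /=; ring.
Qed.

End stationary.

(** * Evaluation for the speed changed rates *)

Section speed_changed_asep.
Context {R : realType} (beta E rho : R) (mu : probability configs R).
Local Notation b := (expR beta).
Local Notation c := (speed_changed_rates beta E).
Local Notation D := (Num.sqrt ((1 - 2 * rho) ^+ 2 + 4 * rho * (1 - rho) * b)).

Lemma integrated_covariance_geometric (x : R) : 0 <= rho <= 1 -> `|x| < 1 ->
  (forall j : int, prob mu (site 0 true `&` site j true) - rho ^+ 2 =
     rho * (1 - rho) * x ^+ `|j|) ->
  integrated_covariance rho mu = (rho * (1 - rho) * (1 + x) / (1 - x))%:E.
Proof.
move=> /andP[r0 r1] x1 cov; rewrite -esum_int_geometric//; last first.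
  by rewrite mulr_ge0// subr_ge0.
rewrite /integrated_covariance.
have -> // : covariance_term rho mu = fun j : int => (rho * (1 - rho) * x ^+ `|j|)%:E.
by apply/funext => j; rewrite covariance_termE cov.
Qed.

Lemma positive_current_speed_changed : positive_current c mu =
  (prob mu (block false true false true) +
   2^-1 * (1 + b^-1) * (prob mu (block false true false false)
                      + prob mu (block true true false true)) +
   b^-1 * prob mu (block true true false false))%:E.
Proof.
have e0 := expR_gt0 (- beta).
rewrite positive_currentE ?ler01 ?(ltW e0) ?mulr_ge0 ?addr_ge0 ?(ltW e0)//=.
rewrite -(pair_bigA _ (fun l r => by_outer_sites _ _ _ l r *
  prob mu (block l true false r)))/= !big_bool/= expRN.
by congr _%:E; ring.
Qed.

Lemma negative_current_speed_changed : negative_current c mu =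
  ((b^-1 * prob mu (block false false true true) +
   2^-1 * (1 + b^-1) * (prob mu (block false false true false)
                      + prob mu (block true false true true)) +
   prob mu (block true false true false)) * expR (- E))%:E.
Proof.
have e0 := expR_gt0 (- beta); have e1 := expR_gt0 (- E).
rewrite negative_currentE /= ?mulr_ge0 ?addr_ge0 ?(ltW e0) ?(ltW e1)//=.
rewrite -(pair_bigA _ (fun l r => by_outer_sites _ _ _ l r *
  prob mu (block l false true r)))/= !big_bool/= expRN.
by congr _%:E; ring.
Qed.

(** A constant configuration allows no jump, and [rho (1 - rho) = 0], so every quantity vanishes. *)
Lemma point_mass_case (a : bool) : rho = a%:R ->
  (forall C : set configs, measurable C -> mu C = dirac ((fun=> a) : configs) C) ->
  [/\ stationary_current c mu = (positive_current c mu * (1 - expR (- E))%:E)%E,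
      positive_current c mu =
        (2 * rho * (1 - rho) * (b + D) / (b * (1 + D) ^+ 2))%:E
    & integrated_covariance rho mu = (rho * (1 - rho) * D)%:E ].
Proof.
move=> rhoE mudirac.
have rho0 : rho * (1 - rho) = 0.
  by rewrite rhoE; case: (a); rewrite ?subrr ?mulr0 ?mul0r.
have probE C : measurable C -> prob mu C = \1_C ((fun=> a) : configs).
  by move=> mC; rewrite /prob mudirac// diracE indicE.
have prob_block0 l r : forall x, prob mu (block l x (~~ x) r) = 0.
  move=> x; rewrite probE; last exact: measurable_block.
  by rewrite indic_block; case: (a) x => -[]; rewrite /= ?andbF.
have pos0 : positive_current c mu = 0%E.
  rewrite positive_current_speed_changed.
  by rewrite !(prob_block0 _ _ true) !(mulr0, addr0).
have neg0 : negative_current c mu = 0%E.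
  rewrite negative_current_speed_changed.
  by rewrite !(prob_block0 _ _ false) !(mulr0, addr0, mul0r).
split.
- by rewrite /stationary_current pos0 neg0 sube0 mul0e.
- have rho20 : 2 * rho * (1 - rho) = 0 by rewrite -mulrA rho0 mulr0.
  by rewrite pos0 rho20 !mul0r.
(* The ratio 0 is an arbitrary choice, since the prefactor is zero. *)
rewrite (@integrated_covariance_geometric 0) ?normr0 ?ltr01//.
- by rewrite rho0 !mul0r.
- by rewrite rhoE; case: (a); rewrite ?ler01 ?lexx.
move=> j; rewrite rho0 mul0r probE; last by apply: measurableI; exact: measurable_site.
rewrite indicE; apply/eqP; rewrite subr_eq0 rhoE; apply/eqP.
by case: (a); rewrite ?expr1n ?expr0n /=; [rewrite mem_set|rewrite memNset// => -[]].
Qed.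

Lemma gibbs_case h : 0 < rho < 1 -> gibbs_measure beta h mu ->
  translation_invariant mu -> mu [set eta : configs | eta 0] = rho%:E ->
  [/\ stationary_current c mu = (positive_current c mu * (1 - expR (- E))%:E)%E,
      positive_current c mu =
        (2 * rho * (1 - rho) * (b + D) / (b * (1 + D) ^+ 2))%:E
    & integrated_covariance rho mu = (rho * (1 - rho) * D)%:E ].
Proof.
move=> /andP[rho_gt0 rho_lt1] gibbs inv_mu mu0.
have b0 := expR_gt0 beta.
have prob0 : prob mu (site 0 true) = rho by rewrite /prob mu0.
have [theta theta0 markov] := gibbs_markov _ _ _ gibbs.
have bal := balance _ _ _ _ b0 theta0 inv_mu prob0 markov.
have bt0 : 0 < b * theta by exact: mulr_gt0.
have bt1 : 1 + b * theta != 0 by rewrite gt_eqF// addr_gt0.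
have t1 : 1 + theta != 0 by rewrite gt_eqF// addr_gt0.
pose N := 1 + 2 * theta + b * theta ^+ 2.
have N0 : 0 < N by rewrite !addr_gt0 ?mulr_gt0 ?exprn_gt0.
have N1 : N != 0 by rewrite gt_eqF.
have rhoN : rho = theta * (1 + b * theta) / N.
  (* Balance of the transitions from particle to hole and from hole to particle, with denominators
     cleared. *)
  have flow : rho * (1 + theta) = (1 - rho) * theta * (1 + b * theta).
    transitivity ((rho - transition b theta true true * rho) *
                  ((1 + b * theta) * (1 + theta))).
      by rewrite /transition; field.
    by rewrite {1}bal /transition; field; rewrite t1 bt1.
  apply: (mulIf N1); rewrite mulfVK// /N.
  transitivity (rho * (1 + theta) + rho * (theta * (1 + b * theta))); first by ring.
  by rewrite flow; ring.
(* In terms of [theta] the radicand is a perfect square. *)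
have DE : D = (1 + 2 * b * theta + b * theta ^+ 2) / N.
  have -> : (1 - 2 * rho) ^+ 2 + 4 * rho * (1 - rho) * b =
      ((1 + 2 * b * theta + b * theta ^+ 2) / N) ^+ 2.
    by rewrite rhoN /N; field.
  rewrite sqrtr_sqr ger0_norm// divr_ge0 ?ltW//.
  by rewrite !addr_gt0 ?mulr_gt0 ?exprn_gt0.
have pb := prob_block _ _ _ _ b0 theta0 inv_mu prob0 markov.
split.
(* Detailed balance at [E = 0]: for each state of the outer sites, the right and left flows agree up
   to the factor [expR (- E)]. *)
- rewrite /stationary_current positive_current_speed_changed
    negative_current_speed_changed -EFinB -EFinM !pb /transition.
  by congr _%:E; field; rewrite ?bt1 ?t1 gt_eqF.
- rewrite positive_current_speed_changed !pb /transition; congr _%:E.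
  rewrite DE rhoN /N; field; rewrite N1 bt1 t1 !gt_eqF//.
  by rewrite !addr_gt0 ?mulr_gt0 ?exprn_gt0.
have cov := correlation_int _ _ _ _ b0 theta0 inv_mu prob0 markov.
(* With [x] the second eigenvalue, [(1 + x) / (1 - x)] is exactly [D]. *)
rewrite (integrated_covariance_geometric _ _ _ cov).
- by congr _%:E; rewrite DE rhoN /transition /N; field; rewrite N1 t1 bt1.
- by rewrite (ltW rho_gt0) (ltW rho_lt1).
(* The eigenvalue is a difference of two numbers in the open unit interval, so its modulus is below
   1. *)
have odds (x : R) : 0 < x -> 0 < x / (1 + x) < 1.
  move=> x0; have x1 : 0 < 1 + x by rewrite addr_gt0.
  by rewrite divr_gt0//= ltr_pdivrMr// mul1r ltrDr.
rewrite /transition ltr_norml.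
have /andP[? ?] := odds _ theta0; have /andP[? ?] := odds _ bt0.
by apply/andP; split; lra.
Qed.

End speed_changed_asep.

Theorem lemma3p10 (R : realType) (beta E rho : R)
    (mu : probability configs R)
    (hrho : 0 <= rho <= 1)
    (hmu : stationary_measure beta rho mu) :
  let c := speed_changed_rates beta E in
  let D := Num.sqrt ((1 - 2 * rho) ^+ 2 + 4 * rho * (1 - rho) * expR beta) in
  [/\ stationary_current c mu =
        (positive_current c mu * (1 - expR (- E))%:E)%E,
      positive_current c mu =
        (2 * rho * (1 - rho) * (expR beta + D)
         / (expR beta * (1 + D) ^+ 2))%:E
    & integrated_covariance rho mu = (rho * (1 - rho) * D)%:E ].
Proof.
case: hmu => mu0 mu1 mug.
case/andP: hrho; rewrite le_eqVlt => /predU1P[/esym rho0 _|rho_gt0].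
  exact: (point_mass_case _ _ _ _ false rho0 (mu0 rho0)).
rewrite le_eqVlt => /predU1P[rho1|rho_lt1].
  exact: (point_mass_case _ _ _ _ true rho1 (mu1 rho1)).
have [|h [gibbs inv_mu mu00]] := mug; first by rewrite rho_gt0.
by apply: (gibbs_case _ _ _ _ h) => //; rewrite rho_gt0.
Qed.
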